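(* For any $\gamma\in(0,1]$ the symmetric two-sided Weibull distribution with parameter $\gamma$ is a scale mixture of normal laws: $$\mathsf P(\widetilde W_{\gamma}<x)=\mathsf E\,\Phi\big(x/\sqrt{2W_1V_{\gamma}^2}\big)=\int_0^{\infty}\Phi\big(x/\sqrt{y}\big)\,dH_{\gamma}(y),\qquad x\in\mathbb R,$$ where $$H_{\gamma}(y)=1-\int_0^{\infty}\exp\big\{-\tfrac18 yz^2\big\}\,dG_{\gamma,1}(z),\qquad y\ge 0,$$ and $W_1$ and $V_\gamma$ are independent.
   Context: For $\gamma>0$, $\widetilde W_\gamma$ is a random variable with the symmetric two-sided Weibull distribution $\mathsf P(\widetilde W_\gamma<x)=\frac12 e^{-|x|^\gamma}\mathbf 1(x<0)+[1-\frac12 e^{-x^\gamma}]\mathbf 1(x\ge 0)$. $\Phi$ is the standard normal distribution function. $W_1$ is a standard exponential random variable. For $\gamma\in(0,1)$, $S_{\gamma,1}$ is a positive random variable with the one-sided strictly stable distribution with characteristic exponent $\gamma$, normalized so that $\mathsf E e^{-sS_{\gamma,1}}=e^{-(2s)^\gamma}$ for $s\ge 0$; for $\gamma=1$ this means $S_{1,1}=2$ almost surely. $G_{\gamma,1}$ is the distribution function of $S_{\gamma,1}$, and $V_\gamma=2S_{\gamma,1}^{-1}$. *)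

(* Defs.v *)
(* MathComp-Analysis *)
From HB Require Import structures.
From mathcomp Require Import all_boot all_order all_algebra.
From mathcomp Require Import all_classical all_reals all_analysis.
From mathcomp Require Import measurable_realfun.

Set Implicit Arguments.
Unset Strict Implicit.
Unset Printing Implicit Defensive.
Import Order.TTheory GRing.Theory Num.Theory.
Import numFieldNormedType.Exports.

Local Open Scope classical_set_scope.
Local Open Scope ring_scope.

Definition std_normal_df (R : realType) (x : R) : R :=
  fine (normal_prob 0 1 `]-oo, x]).

Definition two_sided_Weibull_df (R : realType) (gamma x : R) : R :=
  if x < 0 then 2^-1 * expR (- (`|x| `^ gamma))
  else 1 - 2^-1 * expR (- (x `^ gamma)).

Definition two_sided_Weibull d (T : measurableType d) (R : realType)
    (P : probability T R) (gamma : R) (W : {RV P >-> R}) : Prop :=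
  forall x : R, P [set w | W w < x] = (two_sided_Weibull_df gamma x)%:E.

Definition std_exponential d (T : measurableType d) (R : realType)
    (P : probability T R) (W : {RV P >-> R}) : Prop :=
  forall A : set R, measurable A -> distribution P W A = exponential_prob 1 A.

Definition independent2 d (T : measurableType d) (R : realType)
    (P : probability T R) (X Y : T -> R) : Prop :=
  forall A B : set R, measurable A -> measurable B ->
    P (X @^-1` A `&` Y @^-1` B) = (P (X @^-1` A) * P (Y @^-1` B))%E.

(* For X1, X2 independent copies of S and a, b > 0, the sum a X1 + b X2 has the
   law of (a^gamma + b^gamma)^(1/gamma) S. *)
Definition strictly_stable d (T : measurableType d) (R : realType)
    (P : probability T R) (gamma : R) (S : {RV P >-> R}) : Prop :=
  let mu := distribution P S in
  forall a b : R, 0 < a -> 0 < b -> forall A : set R, measurable A ->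
    (mu \x mu)%E [set z : R * R | A (a * z.1 + b * z.2)] =
    mu [set z : R | A ((a `^ gamma + b `^ gamma) `^ gamma^-1 * z)].

(* S is determined in law by its Laplace transform s |-> exp(- (2 s)^gamma);
   at gamma = 1 this is the point mass at 2. *)
Definition one_sided_stable d (T : measurableType d) (R : realType)
    (P : probability T R) (gamma : R) (S : {RV P >-> R}) : Prop :=
  [/\ gamma < 1 ->
        [/\ {ae P, forall w, 0 < S w},
            strictly_stable gamma S &
            forall s : R, 0 <= s ->
              'E_P[fun w => expR (- (s * S w))]%E
                = (expR (- ((2 * s) `^ gamma)))%:E]
    & gamma = 1 -> {ae P, forall w, S w = 2}].

(* The right-continuous version; it induces the same Stieltjes measure as
   x |-> P(X < x). *)
Definition RV_df d (T : measurableType d) (R : realType)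
    (P : probability T R) (X : {RV P >-> R}) (x : R) : R := fine (cdf X x).

Section RV_df_cumulative.
Context d (T : measurableType d) (R : realType) (P : probability T R).
Variable X : {RV P >-> R}.

Let RV_df_nd : nondecreasing (RV_df X).
Proof. by move=> x y xy; rewrite fine_le ?fin_num_measure ?cdf_nondecreasing. Qed.

Let RV_df_rc : right_continuous (RV_df X).
Proof.
move=> a; apply: fine_cvg.
by rewrite fineK ?fin_num_measure//; exact: cdf_right_continuous.
Qed.

HB.instance Definition _ :=
  isCumulative.Build R _ R (RV_df X) RV_df_nd RV_df_rc.

Let RV_df_Ny : RV_df X @ -oo --> (0 : R).
Proof. exact/fine_cvg/cvg_cdfNy0. Qed.

Let RV_df_y : RV_df X @ +oo --> (1 : R).
Proof. exact/fine_cvg/cvg_cdfy1. Qed.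

HB.instance Definition _ :=
  isCumulativeBounded.Build R 0 1 (RV_df X) RV_df_Ny RV_df_y.

End RV_df_cumulative.

(* If W is standard exponential and independent of Z > 0 with distribution
   function G, then P(2 W (2 / Z)^2 > y) = P(W > y Z^2 / 8) = E exp(- y Z^2 / 8)
   for y >= 0. The function is extended by 0 to y < 0, so that its
   Lebesgue-Stieltjes measure on R is carried by ]0, +oo[. *)
Definition mixing_df (R : realType) (G : cumulativeBounded (0 : R) (1 : R))
    (y : R) : R :=
  if y < 0 then 0
  else 1 - \int[lebesgue_stieltjes_measure G]_(z in `]0, +oo[)
             expR (- (8^-1 * y * z ^+ 2)).

Section mixing_df_cumulative.
Context (R : realType) (G : cumulativeBounded (0 : R) (1 : R)).
Let mu : probability (measurableTypeR R) R := lebesgue_stieltjes_measure G.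
Let D : set (measurableTypeR R) := `]0, +oo[.
Let f (y z : R) : R := expR (- (8^-1 * Num.max 0 y * z ^+ 2)).
Let F (y : R) : R := \int[mu]_(z in D) f y z.

Let mD : measurable D.
Proof. exact: measurable_itv. Qed.

Let f_ge0 y z : 0 <= f y z.
Proof. exact: expR_ge0. Qed.

Let f_le1 y z : f y z <= 1.
Proof.
rewrite -expR0 ler_expR oppr_le0 mulr_ge0 ?sqr_ge0// mulr_ge0 ?invr_ge0//.
by rewrite le_max lexx.
Qed.

Let mf y : measurable_fun D (f y).
Proof.
apply: (@measurable_funTS _ _ (measurableTypeR R) R).
apply: measurableT_comp => //; apply: measurableT_comp => //.
by apply: measurable_funM => //; exact: measurable_funX.
Qed.

Let int_cst : mu.-integrable D (EFin \o cst (1 : R)).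
Proof. exact/finite_measure_integrable_cst. Qed.

Let int_f y : mu.-integrable D (EFin \o f y).
Proof.
apply: (le_integrable mD _ _ int_cst) => [|z _ /=].
  by apply/measurable_EFinP; exact: mf.
by rewrite lee_fin normr1 ger0_norm.
Qed.

Let F_ge0 y : 0 <= F y.
Proof. exact: Rintegral_ge0. Qed.

Let F_le1 y : F y <= 1.
Proof.
apply: (@le_trans _ _ (\int[mu]_(z in D) (cst (1 : R) z))).
  by apply: le_Rintegral => // z _; exact: f_le1.
rewrite Rintegral_cst// mul1r.
rewrite -[leRHS]/(fine 1%E) fine_le ?fin_num_measure//.
exact: probability_le1.
Qed.

Let F_noninc x y : x <= y -> F y <= F x.
Proof.
move=> xy; apply: le_Rintegral => // z _.
rewrite ler_expR lerN2 ler_wpM2r ?sqr_ge0// ler_wpM2l ?invr_ge0//.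
by rewrite ge_max !le_max lexx/= xy orbT.
Qed.

Let F_cts : continuous F.
Proof.
move=> a.
have aI : a \in `]a - 1, a + 1[%classic.
  by rewrite inE/= in_itv/= ltrBlDr !ltrDl ltr01.
apply: (@continuity_under_integral R _ _ mu f D mD (a - 1) (a + 1)
  _ _ (cst 1) int_cst _ a aI) => [x _|/=|x _].
- exact: int_f.
- apply: aeW => z _ x _.
  apply: (cvg_comp (fun y => - (8^-1 * Num.max 0 y * z ^+ 2)) expR);
    last exact: continuous_expR.
  apply: (@cvgN _ R^o); apply: cvgM; last exact: cvg_cst.
  apply: cvgM; first exact: cvg_cst.
  apply: (@continuous_max R R (fun=> 0) id); first exact: cst_continuous.
  exact: cvg_id.
- by apply: aeW => z _; rewrite /= ger0_norm.
Qed.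

Let F_y : F @ +oo --> (0 : R).
Proof.
apply/cvg_pinftyP => u uy.
apply: (@fine_cvg _ _ _ _ _ 0).
rewrite [X in _ --> X](_ : _ = (\int[mu]_(z in D) cst 0%E z)%E); last first.
  by rewrite integral0.
apply: (@dominated_cvg _ _ _ mu D mD (fun n z => (f (u n) z)%:E) (cst 0%E)
  (EFin \o cst (1 : R))) => //=.
- by move=> n; apply/measurable_EFinP; exact: mf.
- move=> z; rewrite /D/= in_itv/= andbT => z0.
  apply: cvg_EFin; first exact: nearW.
  have c0 : 0 < 8^-1 * z ^+ 2 by rewrite mulr_gt0 ?invr_gt0 ?exprn_gt0.
  rewrite (_ : _ \o _ =
    (fun x => expR (- x)) \o (fun n => 8^-1 * z ^+ 2 * Num.max 0 (u n))); last first.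
    by apply/funext => n /=; rewrite /f mulrAC.
  apply: cvg_comp; last exact: cvgr_expR.
  apply/cvgryPge => M; near=> n.
  rewrite -ler_pdivrMl// le_max; apply/orP; right.
  near: n; move/cvgryPge: uy; exact.
- by move=> n z _; rewrite lee_fin ger0_norm.
Unshelve. all: by end_near. Qed.

Let mixing_dfE y : 0 <= y -> mixing_df G y = 1 - F y.
Proof.
move=> y0; rewrite /mixing_df ltNge y0 /F /f /=.
by rewrite (max_idPr y0).
Qed.

Let mixing_df_lt0 y : y < 0 -> mixing_df G y = 0.
Proof. by rewrite /mixing_df => ->. Qed.

Let mixing_df_nd : nondecreasing (mixing_df G).
Proof.
move=> x y xy; have [x0|x0] := ltP x 0.
  rewrite mixing_df_lt0//; have [y0|y0] := ltP y 0; first by rewrite mixing_df_lt0.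
  by rewrite mixing_dfE// subr_ge0.
by rewrite !mixing_dfE ?(le_trans x0)// lerB// F_noninc.
Qed.

Let mixing_df_rc : right_continuous (mixing_df G).
Proof.
move=> a; have [a0|a0] := ltP a 0.
  rewrite mixing_df_lt0//.
  have : (0 : R) @[_ --> a^'+] --> (0 : R) by exact: cvg_cst.
  apply: cvg_trans; apply: near_eq_cvg; near=> x; rewrite mixing_df_lt0//.
rewrite mixing_dfE//.
have : 1 - F x @[x --> a^'+] --> 1 - F a.
  apply: (@cvgB _ R^o); first exact: cvg_cst.
  exact/cvg_at_right_filter/F_cts.
apply: cvg_trans; apply: near_eq_cvg; near=> x.
by rewrite mixing_dfE// (le_trans a0).
Unshelve. all: by end_near. Qed.

HB.instance Definition _ :=
  isCumulative.Build R _ R (mixing_df G) mixing_df_nd mixing_df_rc.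

Let mixing_df_Ny : mixing_df G @ -oo --> (0 : R).
Proof.
have : (0 : R) @[_ --> ninfty_nbhs R] --> (0 : R) by exact: cvg_cst.
apply: cvg_trans; apply: near_eq_cvg; near=> x; rewrite mixing_df_lt0//.
Unshelve. all: by end_near. Qed.

Let mixing_df_y : mixing_df G @ +oo --> (1 : R).
Proof.
have : 1 - F x @[x --> +oo] --> 1 - (0 : R).
  by apply: (@cvgB _ R^o); [exact: cvg_cst|exact: F_y].
rewrite subr0; apply: cvg_trans; apply: near_eq_cvg; near=> x.
by rewrite mixing_dfE.
Unshelve. all: by end_near. Qed.

HB.instance Definition _ :=
  isCumulativeBounded.Build R 0 1 (mixing_df G) mixing_df_Ny mixing_df_y.

End mixing_df_cumulative.

(* Main.v *)
(** For [W] standard exponential, [sqrt (2 W)] times a standard normal variable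
    is symmetric Laplace: for [t > 0] one integrates
    [u exp (- u^2 / 2) Phi (t / u)], [u = sqrt (2 w)], by means of the explicit
    antiderivative
    [(exp t Phi (u + t / u) - exp (- t) Phi (u - t / u)) / 2
     - exp (- u^2 / 2) Phi (t / u)].
    Conditioning on [S], the mixture at [x >= 0] is
    [E (1 - exp (- x S / 2) / 2)], which is read off the Laplace transform of
    [S]. The second equality is the change of variables under
    [w |-> 2 W V^2], whose law has distribution function [mixing_df] because
    [P (2 W (2 / S)^2 > y) = P (W > y S^2 / 8) = E exp (- y S^2 / 8)]. *)

Require Import Defs.
From HB Require Import structures.
From mathcomp Require Import all_boot all_order all_algebra.
From mathcomp Require Import all_classical all_reals all_analysis.
From mathcomp Require Import measurable_realfun ring lra.

Set Implicit Arguments.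
Unset Strict Implicit.
Unset Printing Implicit Defensive.
Import Order.TTheory GRing.Theory Num.Theory.
Import numFieldNormedType.Exports.

Local Open Scope classical_set_scope.
Local Open Scope ring_scope.

(** * Integration against a measure given by a density *)

Section density.
Context d (T : measurableType d) (R : realType).
Variables (mu : {sigma_finite_measure set T -> \bar R}).
Variables (nu : {finite_measure set T -> \bar R}) (p : T -> \bar R).
Local Open Scope ereal_scope.

(** Integrals of [p] over [mu]-null sets vanish, so [nu] is absolutely continuous. Having the same
    integrals over measurable sets as the Radon-Nikodym derivative, [p] equals it almost everywhere,
    and the change of variables applies. *)
Lemma ge0_integral_density (g : T -> \bar R) :
  mu.-integrable setT p ->
  (forall A, measurable A -> nu A = \int[mu]_(x in A) p x) ->
  measurable_fun setT g -> (forall x, 0 <= g x) ->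
  \int[nu]_x g x = \int[mu]_x (g x * p x).
Proof.
move=> pint nuE mg g0.
have numu : nu `<< mu.
  apply/null_content_dominatesP => A mA muA0.
  rewrite nuE//; apply: null_set_integral => //.
  exact: measurable_int (integrableS measurableT mA (@subsetT _ _) pint).
rewrite -(Radon_Nikodym_SigmaFinite.change_of_variables numu)//.
apply: ae_eq_integral => //.
- apply: emeasurable_funM => //.
  exact: measurable_int (Radon_Nikodym_SigmaFinite.f_integrable numu).
- by apply: emeasurable_funM => //; exact: measurable_int pint.
- apply: ae_eqe_mul2l; apply: integral_ae_eq => //.
  + exact: Radon_Nikodym_SigmaFinite.f_integrable.
  + exact: measurable_int pint.
  + by move=> A _ mA; rewrite -Radon_Nikodym_SigmaFinite.f_integral// nuE.
Qed.

End density.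

(** * The standard normal distribution function *)

Section normal_df.
Context (R : realType).
Implicit Types x : R.
Local Notation mu := (@lebesgue_measure R).
Local Notation Phi := (@std_normal_df R).
Local Notation phi := (@normal_pdf R 0 1).

Lemma std_normal_df_ge0 x : 0 <= Phi x.
Proof. by rewrite fine_ge0. Qed.

Lemma std_normal_df_nd : {homo Phi : x y / x <= y}.
Proof.
move=> x y xy; rewrite fine_le ?fin_num_measure// le_measure ?inE//.
exact: subset_itvl.
Qed.

Lemma measurable_std_normal_df : measurable_fun setT Phi.
Proof. exact: nondecreasing_measurable std_normal_df_nd. Qed.

Lemma is_derive_std_normal_df x : is_derive x 1 Phi (phi x).
Proof.
(* The endpoint [x + 1] serves only to keep [x] in the interior. *)
have iphi : mu.-integrable `]-oo, (x + 1)] (EFin \o phi).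
  by apply: (integrableS measurableT) => //; exact: integrable_normal_pdf.
have cphi : {for x, continuous phi}.
  by apply: continuous_normal_pdf; rewrite oner_eq0.
have xx1 : x < x + 1 by rewrite ltrDl.
have [dPhi <-] := continuous_FTC1 xx1 iphi (ltNyr x) cphi.
by rewrite derive1E; exact: derivableP.
Qed.

Lemma continuous_std_normal_df : continuous Phi.
Proof.
move=> x; apply: differentiable_continuous; apply/derivable1_diffP.
by have [] := is_derive_std_normal_df x.
Qed.

(** Under the normal law the identity is a random variable with cdf [Phi]; the limits of [Phi] at
    infinity are then those of a cdf. *)
Let idTR : measurableTypeR R -> R := idfun.

#[local] HB.instance Definition _ :=
  @isMeasurableFun.Build _ _ _ _ idTR (@measurable_id _ _ setT).

Let cdf_Phi : Phi = fine \o cdf (idTR : {RV (normal_prob 0 1) >-> R}).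
Proof.
by apply/funext => x; rewrite /cdf /distribution /pushforward/= preimage_id.
Qed.

Lemma std_normal_df_cvgy : Phi x @[x --> +oo] --> (1 : R).
Proof. rewrite cdf_Phi; exact/fine_cvg/cvg_cdfy1. Qed.

Lemma std_normal_df_cvgNy : Phi x @[x --> -oo] --> (0 : R).
Proof. rewrite cdf_Phi; exact/fine_cvg/cvg_cdfNy0. Qed.

(** The density is even, so [Phi y + Phi (- y)] has derivative zero; its constant value is its limit
    1 at [+oo]. *)
Lemma std_normal_dfN x : Phi (- x) = 1 - Phi x.
Proof.
have cst (y : R) : Phi y + Phi (- y) = Phi x + Phi (- x).
  apply: (@is_derive_0_is_cst _ (fun y => Phi y + Phi (- y))) => z.
  have dN : is_derive z 1 (Phi \o -%R) (phi (- z) * -1).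
    exact: is_derive1_comp (is_derive_std_normal_df _) _.
  have := is_deriveD (is_derive_std_normal_df z) dN.
  rewrite (_ : phi (- z) = phi z) ?mulrN1 ?subrr//.
  by rewrite !normal_pdfE ?oner_eq0// /normal_fun !subr0 sqrrN.
have : (fun y => Phi y + Phi (- y)) y @[y --> +oo] --> 1 + (0 : R).
  apply: (@cvgD _ R^o); first exact: std_normal_df_cvgy.
  by move/cvgNy_compNP: std_normal_df_cvgNy.
under eq_fun do rewrite cst.
move=> /(@cvg_unique _ _ _ _ _ _ (cvg_cst _)) E.
by rewrite -[LHS](addKr (Phi x)) E ?addr0 1?addrC//; exact: Rhausdorff.
Qed.

End normal_df.

(** * Improper integrals over an open half-line *)

Section FTC_oy.
Context (R : realType).

(** Redefining [f] and [F] at [a] by their right limits [c] and [l0] reduces this to the closed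
    half-line; a single point does not change the integral. *)
Lemma ge0_continuous_FTC2_oy (f F : R -> R) (a c l0 l : R) :
  0 <= c -> (forall x, a < x -> 0 <= f x) ->
  (forall x, a < x -> {for x, continuous f}) ->
  f x @[x --> a^'+] --> c -> (forall x, a < x -> is_derive x 1 F (f x)) ->
  F x @[x --> a^'+] --> l0 -> F x @[x --> +oo] --> l ->
  (\int[lebesgue_measure]_(x in `]a, +oo[) (f x)%:E = (l - l0)%:E)%E.
Proof.
move=> c0 f0 cf fac dF Fa Fl.
pose patch (g : R -> R) (b : R) := fun x => if x <= a then b else g x.
have patchE g b x : a < x -> patch g b x = g x.
  by rewrite /patch ltNge; case: ifP.
have near_patch g b x : a < x -> \near x, g x = patch g b x.
  by move=> ax; near do rewrite patchE//; exact: lt_nbhsr.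
have patch_cvg g b : g x @[x --> a^'+] --> b ->
    patch g b x @[x --> a^'+] --> patch g b a.
  rewrite {2}/patch lexx; apply: cvg_trans; apply: near_eq_cvg.
  by near=> x; rewrite patchE.
have dFx x : a < x -> is_derive x 1 (patch F l0) (f x).
  by move=> ax; apply: near_eq_is_derive (dF _ ax); exact: near_patch.
have cf' x : a < x -> {for x, continuous (patch f c)}.
  move=> ax; rewrite /prop_for/continuous_at patchE//.
  apply: cvg_trans (cf _ ax); apply: near_eq_cvg; exact: near_patch.
transitivity (\int[lebesgue_measure]_(x in `]a, +oo[) (patch f c x)%:E)%E.
  apply: eq_integral.
  by move=> x; rewrite inE/= in_itv/= andbT => ax; rewrite patchE.
rewrite integral_itv_obnd_cbnd; last first.
  apply/measurable_EFinP.
  apply: open_continuous_measurable_fun; first exact: interval_open.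
  move=> x.
  by rewrite inE/= in_itv/= andbT => /cf'.
rewrite (@ge0_continuous_FTC2y _ _ (patch F l0) _ l).
- by rewrite /patch lexx.
- by move=> x ax; rewrite /patch; case: ifPn => //; rewrite -ltNge => /f0.
- apply/continuous_within_itvcyP; split; last exact: patch_cvg.
  by move=> x; rewrite in_itv/= andbT => /cf'.
- apply: cvg_trans Fl; apply: near_eq_cvg.
  near=> x; rewrite patchE//; near: x; apply: nbhs_pinfty_gt; exact: num_real.
- by move=> x /dFx [].
- exact: patch_cvg.
- move=> x; rewrite in_itv/= andbT => ax; rewrite patchE// derive1E.
  by have [_ ->] := dFx _ ax.
Unshelve. all: by end_near. Qed.

End FTC_oy.

Lemma cvgryDr (T : Type) (F : set_system T) (FF : Filter F) (R : realFieldType)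
    (f h : T -> R) (M : R) :
  f x @[x --> F] --> +oo -> (\forall x \near F, M <= h x) ->
  f x + h x @[x --> F] --> +oo.
Proof.
move=> fy hM; apply: (ger_cvgy (f := fun x => f x + M)).
  by near do rewrite lerD2l.
exact: cvg_comp fy (cvg_addrr M).
Unshelve. all: by end_near. Qed.

(** * An exponential mixture of normal laws is a Laplace law *)

Section exponential_mixture.
Context (R : realType).
Local Notation Phi := (@std_normal_df R).
Local Notation phi := (@normal_pdf R 0 1).

(** As [(u + t / u)^2 / 2 = (u^2 + t^2 / u^2) / 2 + t], and likewise with both signs changed, the
    three Gaussian products that arise on differentiating [B] are all this kernel. *)
Let K (t u : R) : R :=
  normal_peak 1 * expR (- ((u ^+ 2 + t ^+ 2 / u ^+ 2) / 2)).

Let phiE (x : R) : phi x = normal_peak 1 * expR (- (x ^+ 2 / 2)).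
Proof.
by rewrite normal_pdfE ?oner_eq0// /normal_fun subr0 expr1n mulNr.
Qed.

Let phiD (t u : R) : 0 < u -> expR t * phi (u + t / u) = K t u.
Proof.
move=> u0; rewrite phiE /K mulrCA -expRD; congr (_ * expR _).
by field; rewrite gt_eqF.
Qed.

Let phiB (t u : R) : 0 < u -> expR (- t) * phi (u - t / u) = K t u.
Proof.
move=> u0; rewrite phiE /K mulrCA -expRD; congr (_ * expR _).
by field; rewrite gt_eqF.
Qed.

Let phiV (t u : R) : 0 < u -> expR (- (u ^+ 2 / 2)) * phi (t / u) = K t u.
Proof.
move=> u0; rewrite phiE /K mulrCA -expRD; congr (_ * expR _).
by field; rewrite gt_eqF.
Qed.

(* An antiderivative of u |-> u exp(- u^2 / 2) Phi(t / u) on ]0, +oo[. *)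
Let B (t u : R) : R :=
  2^-1 * (expR t * Phi (u + t / u) - expR (- t) * Phi (u - t / u))
  - expR (- (u ^+ 2 / 2)) * Phi (t / u).

(** The kernel terms cancel: the bracket contributes [- (t / u^2) * K t u], and differentiating
    [Phi (t / u)] in the last product contributes the opposite. *)
Let is_derive_B (t u : R) : 0 < u ->
  is_derive u 1 (B t) (u * (expR (- (u ^+ 2 / 2)) * Phi (t / u))).
Proof.
move=> u0.
have dinv : is_derive u 1 (fun y : R => t / y) (- (t / u ^+ 2)).
  have := is_deriveZ t (is_deriveV (lt0r_neq0 u0) (is_derive_id u (1 : R))).
  by move=> /is_derive_eq; apply; rewrite /GRing.scale/= mulr1 mulrN.
have dD : is_derive u 1 (fun y : R => y + t / y) (1 - t / u ^+ 2).
  exact: is_deriveD.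
have dB : is_derive u 1 (fun y : R => y - t / y) (1 + t / u ^+ 2).
  by rewrite -[t / u ^+ 2]opprK; exact: is_deriveB.
have dPhi (g : R -> R) dg : is_derive u 1 g dg ->
    is_derive u 1 (fun y => Phi (g y)) (phi (g u) * dg).
  exact: is_derive1_comp (is_derive_std_normal_df _).
have dexp : is_derive u 1 (fun y : R => expR (- (y ^+ 2 / 2)))
    (expR (- (u ^+ 2 / 2)) * - u).
  apply: (is_derive1_comp (f := expR) (g := fun y : R => - (y ^+ 2 / 2))).
  have dsq : is_derive u 1 (fun y : R => y ^+ 2) (2 * u).
    have := is_deriveX 2 (is_derive_id u (1 : R)) => /is_derive_eq.
    by apply; rewrite /GRing.scale/= expr1 mulr1.
  rewrite (_ : (fun y => _) = - 2^-1 \*: (fun y : R => y ^+ 2)); last first.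
    by apply/funext => y /=; rewrite /GRing.scale/= mulNr mulrC.
  have := is_deriveZ (- 2^-1) dsq.
  by move=> /is_derive_eq; apply; rewrite /GRing.scale/=; field.
have d1 := is_deriveB (is_deriveZ (expR t) (dPhi _ _ dD))
  (is_deriveZ (expR (- t)) (dPhi _ _ dB)).
have d2 := is_deriveM dexp (dPhi _ _ dinv).
have := is_deriveB (is_deriveZ 2^-1 d1) d2.
move=> /is_derive_eq; apply.
rewrite /GRing.scale/= [expR t * _]mulrA [expR (- t) * _]mulrA phiD// phiB//.
rewrite [_ * (phi _ * _)]mulrA phiV//.
by field; rewrite gt_eqF.
Qed.

(** The substitution [u = r w]: its derivative [(r w)^-1] absorbs the factor [u] in the derivative
    of [B], and [u^2 / 2] becomes [w]. *)
Let r (w : R) : R := Num.sqrt (2 * w).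

Let r_gt0 (w : R) : 0 < w -> 0 < r w.
Proof. by move=> w0; rewrite sqrtr_gt0 mulr_gt0. Qed.

Let sqr_r (w : R) : 0 < w -> r w ^+ 2 / 2 = w.
Proof.
move=> w0; rewrite sqr_sqrtr ?mulr_ge0 ?ltW//.
by rewrite mulrAC divff ?mul1r// pnatr_eq0.
Qed.

Let is_derive_r (w : R) : 0 < w -> is_derive w 1 r (r w)^-1.
Proof.
move=> w0; have d2 : is_derive w (1 : R) (fun y : R => 2 * y) 2.
  have := is_deriveZ 2 (is_derive_id w (1 : R)).
  by rewrite /GRing.scale/= mulr1.
have w20 : 0 < 2 * w by rewrite mulr_gt0.
have := is_derive1_comp (is_derive1_sqrt w20) d2.
move=> /is_derive_eq; apply.
by rewrite /r invfM mulrAC mulVf ?mul1r// pnatr_eq0.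
Qed.

Let continuous_r : continuous r.
Proof.
move=> w; apply: continuous_comp; last exact: sqrt_continuous.
exact: mulrl_continuous.
Qed.

Let r_cvg0 : r w @[w --> 0^'+] --> 0.
Proof.
apply: cvg_at_right_filter.
by have := continuous_r (x := 0); rewrite /continuous_at {2}/r mulr0 sqrtr0.
Qed.

Let r_cvgy : r w @[w --> +oo] --> +oo.
Proof.
apply/cvgryPge => A; near=> w.
rewrite (le_trans (ler_norm _))// -sqrtr_sqr ler_wsqrtr//.
rewrite -ler_pdivrMl//; near: w; apply: nbhs_pinfty_ge; exact: num_real.
Unshelve. all: by end_near. Qed.

Let tr_cvgy (t : R) : 0 < t -> t / r w @[w --> 0^'+] --> +oo.
Proof.
move=> t0; apply/gtr0_cvgV0.
  by near=> w; rewrite divr_gt0// r_gt0.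
rewrite (_ : unstable.inv_fun _ = fun w => r w * t^-1); last first.
  by apply/funext => w; rewrite /unstable.inv_fun/= invf_div.
rewrite -[X in _ --> X](mul0r t^-1); apply: cvgM => //; exact: cvg_cst.
Unshelve. all: by end_near. Qed.

Let tr_cvg0 (t : R) : t / r w @[w --> +oo] --> (0 : R).
Proof.
rewrite -[X in _ --> X](mulr0 t); apply: cvgM; first exact: cvg_cst.
apply/gtr0_cvgV0; last exact: r_cvgy.
by near=> w; apply: r_gt0; near: w; apply: nbhs_pinfty_gt; exact: num_real.
Unshelve. all: by end_near. Qed.

(** With [u = r w], the arguments [u + t / u] and [t / u] tend to [+oo] while [u - t / u] tends to
    [-oo], so the three values of [Phi] tend to 1, 1 and 0. *)
Let Br_cvg0 (t : R) : 0 < t -> B t (r w) @[w --> 0^'+] --> 2^-1 * expR t - 1.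
Proof.
move=> t0.
have Phi1 (g : R -> R) : g w @[w --> 0^'+] --> +oo ->
    Phi (g w) @[w --> 0^'+] --> (1 : R).
  by move=> gy; exact: cvg_comp gy (@std_normal_df_cvgy R).
rewrite (_ : _ - 1 = 2^-1 * (expR t * 1 - expR (- t) * 0)
  - expR (- (0 ^+ 2 / 2)) * 1); last first.
  by rewrite expr0n/= mul0r oppr0 expR0; ring.
apply: (@cvgB _ R^o).
  apply: cvgM; first exact: cvg_cst.
  apply: (@cvgB _ R^o); apply: cvgM; try exact: cvg_cst.
    apply: Phi1; under eq_fun do rewrite addrC.
    apply: (cvgryDr _ (tr_cvgy t0) (M := 0)).
    by near=> w; rewrite ltW// r_gt0.
  apply: (cvg_comp _ Phi); last exact: (@std_normal_df_cvgNy R).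
  apply/cvgNry.
  rewrite (_ : - _ = fun w => t / r w + - r w); last first.
    by apply/funext => w /=; rewrite opprB.
  apply: (cvgryDr _ (tr_cvgy t0) (M := -1)).
  near=> w; rewrite lerN2; near: w.
  apply: (cvgr_le _ r_cvg0); exact: ltr01.
apply: cvgM; last exact/Phi1/tr_cvgy.
apply: (cvg_comp _ expR); last exact: continuous_expR.
apply: (@cvgN _ R^o); apply: cvgM; last exact: cvg_cst.
by rewrite expr2; apply: cvgM.
Unshelve. all: by end_near. Qed.

(** Now [t / r w] tends to 0, so both arguments in the bracket tend to [+oo], and the factor
    [expR (- w)] removes the last product. *)
Let Br_cvgy (t : R) :
  B t (r w) @[w --> +oo] --> 2^-1 * (expR t - expR (- t)).
Proof.
have Phi1 (g : R -> R) : g w @[w --> +oo] --> +oo ->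
    Phi (g w) @[w --> +oo] --> (1 : R).
  by move=> gy; exact: cvg_comp gy (@std_normal_df_cvgy R).
rewrite (_ : 2^-1 * _ = 2^-1 * (expR t * 1 - expR (- t) * 1) - 0 * Phi 0);
  last by rewrite mul0r subr0 !mulr1.
apply: (@cvgB _ R^o).
  apply: cvgM; first exact: cvg_cst.
  apply: (@cvgB _ R^o); apply: cvgM; try exact: cvg_cst.
    apply/Phi1/(cvgryDr _ r_cvgy (M := -1)).
    by apply: (cvgr_ge _ (tr_cvg0 t)); rewrite ltrN10.
  apply/Phi1/(cvgryDr _ r_cvgy (M := -1)); near=> w; rewrite lerN2; near: w.
  by apply: (cvgr_le _ (tr_cvg0 t)); exact: ltr01.
apply: cvgM; last first.
  by apply: cvg_comp (tr_cvg0 t) _; exact: continuous_std_normal_df.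
apply: cvg_trans (@cvgr_expR R); apply: near_eq_cvg; near=> w.
by rewrite sqr_r//; near: w; apply: nbhs_pinfty_gt; exact: num_real.
Unshelve. all: by end_near. Qed.

Lemma integral_expR_std_normal_df (t : R) : 0 < t ->
  (\int[lebesgue_measure]_(w in `]0%R, +oo[)
     (expR (- w) * Phi (t / Num.sqrt (2 * w)))%:E)%E
  = (1 - 2^-1 * expR (- t))%:E.
Proof.
move=> t0.
(* The limits of [B t (r w)] at [+oo] and at 0, subtracted. *)
have -> : 1 - 2^-1 * expR (- t) =
  2^-1 * (expR t - expR (- t)) - (2^-1 * expR t - 1) by ring.
apply: (@ge0_continuous_FTC2_oy R (fun w => expR (- w) * Phi (t / r w))
  (fun w => B t (r w)) 0 1 (2^-1 * expR t - 1)
  (2^-1 * (expR t - expR (- t)))).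
- exact: ler01.
- by move=> w _; rewrite mulr_ge0 ?expR_ge0// std_normal_df_ge0.
- move=> w w0; apply: cvgM.
    apply: (cvg_comp _ expR); last exact: continuous_expR.
    exact: (@cvgN _ R^o).
  apply: (cvg_comp _ Phi); last exact: continuous_std_normal_df.
  apply: cvgM; first exact: cvg_cst.
  by apply: cvgV; [rewrite gt_eqF// r_gt0|exact: continuous_r].
(* The right limit at 0 is 1, whereas the value there is 1/2, since [t / 0] is 0 by convention. *)
- rewrite [X in _ --> X](_ : 1 = expR (- 0) * 1); last first.
    by rewrite oppr0 expR0 mulr1.
  apply: cvgM.
    apply: (cvg_comp _ expR); last exact: continuous_expR.
    by apply: (@cvgN _ R^o); exact: cvg_at_right_filter.
  apply: cvg_comp (tr_cvgy t0) _; exact: std_normal_df_cvgy.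
- move=> w w0.
  have := is_derive1_comp (is_derive_B t (r_gt0 w0)) (is_derive_r w0).
  move=> /is_derive_eq; apply; rewrite sqr_r// mulrAC divff ?mul1r//.
  by rewrite gt_eqF// r_gt0.
- exact: Br_cvg0.
- exact: Br_cvgy.
Qed.

End exponential_mixture.

(** * Values at the origin, symmetry, and measurability of inverse and root *)

Lemma std_normal_df0 (R : realType) : std_normal_df (0 : R) = 2^-1.
Proof.
have := std_normal_dfN (0 : R); rewrite oppr0 => H; lra.
Qed.

Lemma two_sided_Weibull_dfN (R : realType) (gamma x : R) : 0 < gamma ->
  two_sided_Weibull_df gamma (- x) = 1 - two_sided_Weibull_df gamma x.
Proof.
move=> gamma0; rewrite /two_sided_Weibull_df oppr_lt0.
have [x0|x0|->] := ltgtP x 0.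
- by rewrite ler0_norm// ltW.
- by rewrite normrN ger0_norm ?ltW//; ring.
(* The power of 0 vanishes because [gamma] is nonzero; both sides are then 1/2. *)
- by rewrite oppr0 powR0 ?gt_eqF// oppr0 expR0; field.
Qed.

Lemma measurable_inv (R : realType) : measurable_fun [set: R] (@GRing.inv R).
Proof.
(* Continuity fails only at 0, which is split off as a singleton. *)
rewrite -(setUv [set 0]); apply/measurable_funU => //.
  exact: measurableC.
split; first exact: measurable_fun_set1.
apply: open_continuous_measurable_fun.
  by rewrite openC; exact: closed_eq.
by move=> x; rewrite inE/= => /eqP x0; exact: inv_continuous.
Qed.

Lemma measurable_sqrt (R : realType) : measurable_fun [set: R] (@Num.sqrt R).
Proof.
apply: continuous_measurable_fun; exact: sqrt_continuous.
Qed.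

(** * Integrals and distribution function of the exponential law *)

Section exponential_law.
Context (R : realType) (nu : probability (measurableTypeR R) R).
Hypothesis nuE : forall A, measurable A -> nu A = exponential_prob 1 A.
Local Notation Phi := (@std_normal_df R).
Local Notation mu := (@lebesgue_measure R).

Lemma ge0_integral_exponential (g : R -> \bar R) :
  measurable_fun [set: measurableTypeR R] g -> (forall x, 0 <= g x)%E ->
  (\int[nu]_x g x = \int[mu]_(x in `]0%R, +oo[) (g x * (expR (- x))%:E))%E.
Proof.
move=> mg g0.
rewrite (@ge0_integral_density _ _ _ mu nu (EFin \o exponential_pdf 1))//;
    last first.
  exact: integrable_exponential_pdf.
(* The density is cut off on the closed half-line, so the null point 0 is added first. *)
rewrite integral_itv_obnd_cbnd; last first.
  apply: emeasurable_funM; first exact: measurable_funTS.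
  apply/measurable_EFinP/measurable_funTS/measurableT_comp => //.
rewrite [RHS]integral_mkcond; apply: eq_integral => x _.
rewrite /= /exponential_pdf !patchE; case: ifPn => _; last by rewrite mule0.
by rewrite mul1r mulN1r.
Qed.

Lemma exponential_law_itvNyc (a : R) :
  nu `]-oo, a]%classic = (if a < 0 then (0 : R) else 1 - expR (- a))%:E.
Proof.
rewrite nuE; last exact: measurable_itv.
rewrite /exponential_prob; case: ltP => a0.
  rewrite integral0_eq// => x; rewrite /= in_itv/= => xa.
  by rewrite lt0_exponential_pdf// (le_lt_trans xa).
have -> : (\int[mu]_(x in `]-oo, a]) (exponential_pdf 1 x)%:E =
  exponential_prob 1 `[0%R, a])%E.
  rewrite /exponential_prob integral_mkcond [RHS]integral_mkcond.
  apply: eq_integral => x _; rewrite !patchE !mem_setE !in_itv/=.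
  by case: (ltP x 0) => //= x0; rewrite lt0_exponential_pdf// if_same.
(* The closed formula for the interval from 0 to [a] requires [a] positive; at 0 the interval is a
   point. *)
move: a0; rewrite le_eqVlt => /predU1P[<-|a0].
  by rewrite /exponential_prob set_itv1 integral_set1 oppr0 expR0 subrr.
by rewrite exponential_prob_itv0c// mulN1r.
Qed.

Lemma measurable_std_normal_df_scale (t : R) :
  measurable_fun setT (fun w : R => Phi (t / Num.sqrt (2 * w))).
Proof.
apply: (measurableT_comp (@measurable_std_normal_df R)).
apply: measurable_funM => //.
apply: (measurableT_comp (@measurable_inv R)).
apply: (measurableT_comp (@measurable_sqrt R)).
exact: measurable_funM.
Qed.

(** At parameter 1 the two-sided Weibull law is the symmetric Laplace law; this extends the integral
    for positive [t] to all real [t]. *)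
Lemma exponential_mixture_std_normal_df (t : R) :
  (\int[nu]_w (Phi (t / Num.sqrt (2 * w)))%:E)%E =
  (two_sided_Weibull_df 1 t)%:E.
Proof.
have mPhi s : measurable_fun [set: measurableTypeR R]
    (fun w : measurableTypeR R => (Phi (s / Num.sqrt (2 * w)))%:E).
  apply/measurable_EFinP; exact: measurable_std_normal_df_scale.
have Phi0 s (w : R) : (0 <= (Phi (s / Num.sqrt (2 * w)))%:E)%E.
  by rewrite lee_fin std_normal_df_ge0.
(* By the symmetry of [Phi], the integrals for [t] and [- t] add up to 1, which also rules out
   infinite values. *)
wlog t0 : t / 0 <= t.
  move=> H; have [/H//|t0] := leP 0 t.
  have := H (- t); rewrite oppr_ge0 ltW// => /(_ isT).
  rewrite two_sided_Weibull_dfN// => HN.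
  have : (\int[nu]_w ((Phi (t / Num.sqrt (2 * w)))%:E +
      (Phi (- t / Num.sqrt (2 * w)))%:E) = 1)%E.
    under eq_integral do rewrite mulNr std_normal_dfN -EFinD subrKC.
    by rewrite integral_cst// mul1e; exact: probability_setT.
  rewrite ge0_integralD// HN; case: (\int[nu]_w _)%E => [s| |]//= [] H1.
  by congr EFin; lra.
rewrite /two_sided_Weibull_df ltNge t0/= powRr1//.
(* At [t = 0] the integrand is the constant 1/2; the antiderivative handles only [t > 0]. *)
move: t0; rewrite le_eqVlt => /predU1P[<-|t0].
  under eq_integral do rewrite mul0r std_normal_df0.
  rewrite integral_cst// [X in (_ * X)%E](@probability_setT _ _ _ nu) mule1.
  rewrite oppr0 expR0.
  by congr EFin; field.
rewrite ge0_integral_exponential// -integral_expR_std_normal_df//.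
by apply: eq_integral => w _; rewrite -EFinM mulrC.
Qed.

End exponential_law.

(** * Tonelli for independent variables *)

Section independence.
Context d (T : measurableType d) (R : realType) (P : probability T R).

(** By independence the joint law agrees with the product of the marginals on rectangles, hence
    everywhere; Tonelli then gives the iterated integral. *)
Lemma ge0_integral_independent2 (X Y : {RV P >-> R}) (h : R * R -> \bar R) :
  independent2 P X Y -> measurable_fun setT h -> (forall z, 0 <= h z)%E ->
  (\int[P]_w h (X w, Y w) =
   \int[P]_v \int[P]_w h (X w, Y v))%E.
Proof.
move=> XY mh h0.
have mXY : measurable_fun setT (fun w => (X w, Y w)).
  exact: measurable_fun_pair.
have := @fubini_tonelli2 _ _ _ _ _ (distribution P X) (distribution P Y) _
  mh h0.
rewrite ge0_integral_distribution; first last.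
- by move=> y; apply: integral_ge0.
- exact: measurable_fun_fubini_tonelli_G.
rewrite /fubini_G/= => XYE.
transitivity (\int[P]_v \int[distribution P X]_x h (x, Y v))%E; last first.
  apply: eq_integral => v _; rewrite ge0_integral_distribution//.
  exact: measurable_fun_pair1.
rewrite -XYE -[LHS](ge0_integral_pushforward mXY P measurableT mh)//.
apply/esym/eq_measure_integral => A mA _.
exact: (product_measure_unique (m' := pushforward P (fun w => (X w, Y w)))).
Qed.

Lemma independent2_comp (X Y : T -> R) (f : R -> R) : measurable_fun setT f ->
  independent2 P X Y -> independent2 P X (f \o Y).
Proof.
move=> mf XY A B mA mB; rewrite comp_preimage; apply: XY => //.
by rewrite -[X in measurable X]setTI; exact: mf.
Qed.

End independence.

(* [R] and [measurableTypeR R] have the same measurable sets, but distinct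
   displays: Lebesgue-Stieltjes measures live on the latter. *)
Definition borel_fun (T : Type) (R : realType) (X : T -> R) :
  T -> measurableTypeR R := X.

HB.instance Definition _ d (T : measurableType d) (R : realType)
    (P : probability T R) (X : {RV P >-> R}) :=
  @isMeasurableFun.Build _ _ T (measurableTypeR R) (borel_fun X)
    (measurable_funPT X).

(** * Probability laws as Lebesgue-Stieltjes measures *)

Section lebesgue_stieltjes_df.
Context (R : realType).

Lemma probability_itvoc (mu : probability (measurableTypeR R) R) (a b : R) :
  a <= b ->
  mu `]a, b]%classic = (mu `]-oo, b]%classic - mu `]-oo, a]%classic)%E.
Proof.
move=> ab; have -> : `]a, b]%classic = `]-oo, b] `\` `]-oo, a] :> set R.
  apply/seteqP; split=> x /=; rewrite !in_itv/=.
    by move=> /andP[ax ->]; split => //; apply/negP; rewrite -ltNge.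
  by move=> [-> /negP]; rewrite -ltNge => ->.
rewrite measureD ?setIidr//; first exact: subset_itvl.
by rewrite -ge0_fin_numE// fin_num_measure.
Qed.

(** By uniqueness it suffices to compare half-open intervals, whose masses are differences of values
    of [f]. *)
Lemma lebesgue_stieltjes_measure_eq (f : cumulativeBounded (0 : R) (1 : R))
    (mu : probability (measurableTypeR R) R) :
  (forall x, mu `]-oo, x]%classic = (f x)%:E) ->
  forall A, measurable A -> lebesgue_stieltjes_measure f A = mu A.
Proof.
move=> muE; apply: lebesgue_stieltjes_measure_unique => _ [[a b]]/= _ <-.
pose nu : probability (measurableTypeR R) R := lebesgue_stieltjes_measure f.
have fE x : nu `]-oo, x]%classic = (f x)%:E.
  rewrite -cdf_lebesgue_stieltjes_id.
  by rewrite /cdf /distribution /pushforward preimage_id.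
have [ab|ba] := leP a b; last first.
  by rewrite set_itv_ge ?measure0// bnd_simp -leNgt ltW.
by rewrite -[LHS]/(nu _) !probability_itvoc// !fE !muE.
Qed.

Lemma lebesgue_stieltjes_RV_df d (T : measurableType d) (P : probability T R)
    (X : {RV P >-> R}) A :
  measurable A ->
  lebesgue_stieltjes_measure (RV_df X) A = distribution P (borel_fun X) A.
Proof.
move: A; apply: (@lebesgue_stieltjes_measure_eq (RV_df X)
  (distribution P (borel_fun X))) => x.
by rewrite /RV_df fineK// fin_num_measure.
Qed.

End lebesgue_stieltjes_df.

(* The value at x of the df of the symmetric Laplace law of rate s / 2. *)
Definition laplace_df (R : realType) (x s : R) : R :=
  if x < 0 then 2^-1 * expR (- (`|x| / 2 * s))
  else 1 - 2^-1 * expR (- (`|x| / 2 * s)).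

Lemma measurable_laplace_df (R : realType) (x : R) :
  measurable_fun setT (laplace_df x).
Proof.
rewrite /laplace_df; case: (x < 0).
  apply: measurable_funM => //; apply: measurableT_comp => //.
  by apply: measurableT_comp => //; exact: measurable_funM.
apply: measurable_funB => //.
apply: measurable_funM => //; apply: measurableT_comp => //.
by apply: measurableT_comp => //; exact: measurable_funM.
Qed.

(** * Conditioning on [S] *)

Section scale_mixture.
Context d (T : measurableType d) (R : realType) (P : probability T R).
Variables W S : {RV P >-> R}.
Hypothesis hW : std_exponential W.
Hypothesis WS : independent2 P W S.
Hypothesis S_gt0 : {ae P, forall w, 0 < S w}.
Local Notation Phi := (@std_normal_df R).

Let nu : probability (measurableTypeR R) R := distribution P (borel_fun W).

Let nuE A : measurable A -> nu A = exponential_prob 1 A.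
Proof. by move=> mA; rewrite -hW. Qed.

Let mixture (t : R) :
  (\int[P]_w (Phi (t / Num.sqrt (2 * W w)))%:E)%E =
  (two_sided_Weibull_df 1 t)%:E.
Proof.
rewrite -(exponential_mixture_std_normal_df nuE).
rewrite /nu ge0_integral_distribution//.
  apply/measurable_EFinP; exact: measurable_std_normal_df_scale.
by move=> y; rewrite lee_fin std_normal_df_ge0.
Qed.

Let g (z : R * R) : R := 2 * z.1 * (2 / z.2) ^+ 2.

Let mg : measurable_fun setT g.
Proof.
apply: measurable_funM; first exact: measurable_funM.
apply: measurable_funX; apply: measurable_funM => //.
exact: (measurableT_comp (@measurable_inv R)).
Qed.

Lemma integral_Phi_mixture (x : R) :
  (\int[P]_w (Phi (x / Num.sqrt (2 * W w * (2 / S w) ^+ 2)))%:E =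
   \int[P]_w (laplace_df x (S w))%:E)%E.
Proof.
pose h z := (Phi (x / Num.sqrt (g z)))%:E.
have mh : measurable_fun setT h.
  apply/measurable_EFinP.
  apply: (measurableT_comp (@measurable_std_normal_df R)).
  apply: measurable_funM => //.
  apply: (measurableT_comp (@measurable_inv R)).
  exact: (measurableT_comp (@measurable_sqrt R)).
have h0 z : (0 <= h z)%E by rewrite lee_fin std_normal_df_ge0.
rewrite (ge0_integral_independent2 WS mh h0).
apply: ae_eq_integral => //.
- have mhW : measurable_fun setT (fun z : T * R => h (W z.1, z.2)).
    apply: (measurableT_comp mh); apply: measurable_fun_pair => //.
    exact: measurableT_comp.
  apply: (measurableT_comp (f := fun s => \int[P]_w h (W w, s))%E) => //.
  by apply: (measurable_fun_fubini_tonelli_G (m1 := P) _ mhW).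
- by apply/measurable_EFinP/(measurableT_comp (measurable_laplace_df x)).
- apply: filterS S_gt0 => v Sv0 _.
  (* For fixed [S v > 0] the scale [2 / S v] leaves the square root, so the inner integral is the
     Laplace mixture at [x * (S v / 2)]. *)
  transitivity (\int[P]_w (Phi (x * (S v / 2) / Num.sqrt (2 * W w)))%:E)%E.
    apply: eq_integral => w _; congr (Phi _)%:E.
    rewrite /g/= [2 * W w * _]mulrC sqrtrM ?sqr_ge0// sqrtr_sqr.
    rewrite ger0_norm ?divr_ge0 ?ltW// invfM invf_div; exact: mulrA.
  have nE : `|x * (S v / 2)| = `|x| / 2 * S v.
    by rewrite normrM [`|S v / 2|]ger0_norm ?divr_ge0 ?ltW// mulrA mulrAC.
  rewrite mixture /two_sided_Weibull_df /laplace_df.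
  rewrite pmulr_llt0 ?divr_gt0//.
  case: ltP => x0; rewrite -nE; first by rewrite powRr1.
  have xS0 : 0 <= x * (S v / 2) by rewrite mulr_ge0// divr_ge0// ltW.
  by rewrite powRr1// ger0_norm.
Qed.

Lemma cdf_mixture (y : R) :
  P [set w | 2 * W w * (2 / S w) ^+ 2 <= y] =
  (if (y < 0)%R then 0
   else \int[P]_w (1 - expR (- (8^-1 * y * S w ^+ 2)))%:E)%E.
Proof.
pose A : set (R * R) := g @^-1` `]-oo, y].
have -> : [set w | 2 * W w * (2 / S w) ^+ 2 <= y] =
    (fun w => (W w, S w)) @^-1` A.
  by apply/seteqP; split => w; rewrite /A/= in_itv.
have mA : measurable A.
  by rewrite -[A]setTI; exact: (mg measurableT (measurable_itv `]-oo, y])).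
have mh : measurable_fun setT (fun z : R * R => (\1_A z)%:E : \bar R).
  exact/measurable_EFinP/measurable_indic.
have h0 (z : R * R) : (0 <= (\1_A z)%:E :> \bar R)%E by rewrite lee_fin.
have mWS : measurable_fun setT (fun w => (W w, S w)).
  exact: measurable_fun_pair.
transitivity (\int[P]_w (\1_A (W w, S w))%:E)%E.
  rewrite -[X in P X]setIT -integral_indic//.
  by rewrite -[X in measurable X]setTI; exact: mWS.
rewrite (ge0_integral_independent2 WS mh h0).
transitivity (\int[P]_w (if (y < 0)%R then 0 else
    (1 - expR (- (8^-1 * y * S w ^+ 2)))%:E))%E; last first.
  by case: (y < 0) => //; rewrite integral0.
apply: ae_eq_integral => //.
- have mhW : measurable_fun setT
      (fun z : T * R => (\1_A (W z.1, z.2))%:E : \bar R).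
    apply: (measurableT_comp mh); apply: measurable_fun_pair => //.
    exact: measurableT_comp.
  apply: (measurableT_comp
    (f := fun s => \int[P]_w (\1_A (W w, s))%:E)%E) => //.
  by apply: (measurable_fun_fubini_tonelli_G (m1 := P) _ mhW).
- case: (y < 0) => //; apply/measurable_EFinP; apply: measurable_funB => //.
  apply: measurableT_comp => //; apply: measurableT_comp => //.
  by apply: measurable_funM => //; exact: measurable_funX.
- apply: filterS S_gt0 => v Sv0 _.
  (* For fixed [S v > 0] the event is a half-line for [W w], as [2 * 2^2 = 8]. *)
  have WA w : (W w, S v) \in A = (w \in W @^-1` `]-oo, 8^-1 * y * S v ^+ 2]).
    have gE : 2 * W w * (2 / S v) ^+ 2 = W w / (8^-1 * S v ^+ 2).
      by field; rewrite gt_eqF.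
    have c0 : 0 < 8^-1 * S v ^+ 2 by rewrite mulr_gt0// exprn_gt0.
    have yE : y * (8^-1 * S v ^+ 2) = 8^-1 * y * S v ^+ 2 by ring.
    apply/idP/idP; rewrite !inE /A/= !in_itv/= /g/= gE ler_pdivrMr// yE//.
  transitivity (nu `]-oo, 8^-1 * y * S v ^+ 2]%classic).
    rewrite -[RHS]/(P (W @^-1` `]-oo, 8^-1 * y * S v ^+ 2])).
    rewrite -[X in P X]setIT -integral_indic//.
    by apply: eq_integral => w _; rewrite !indicE WA.
    by apply: measurable_funPTI; exact: measurable_itv.
  (* The threshold has the sign of [y], so the two case distinctions coincide. *)
  rewrite (exponential_law_itvNyc nuE _) pmulr_llt0 ?exprn_gt0// pmulr_rlt0//.
  by case: ifP.
Qed.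

End scale_mixture.

Lemma integral_cst_probability d (T : measurableType d) (R : realType)
  (P : probability T R) (c : \bar R) : (\int[P]_w cst c w = c)%E.
Proof.
rewrite integral_cst// [X in (_ * X)%E](@probability_setT _ _ _ P).
exact: mule1.
Qed.

(** * Positivity and Laplace transform of [S], including [gamma = 1] *)

Section one_sided_stable.
Context d (T : measurableType d) (R : realType) (P : probability T R).
Variables (gamma : R) (S : {RV P >-> R}).
Hypotheses (gamma01 : 0 < gamma <= 1) (hS : one_sided_stable gamma S).

Lemma one_sided_stable_gt0 : {ae P, forall w, 0 < S w}.
Proof.
have /andP[_] := gamma01; rewrite le_eqVlt => /predU1P[g1|/hS.1[]//].
by apply: filterS (hS.2 g1) => w ->.
Qed.

(** For [gamma = 1] the point mass at 2 has transform [expR (- (2 * s))], which is the stable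
    formula with exponent 1. *)
Lemma one_sided_stable_laplace (s : R) : 0 <= s ->
  (\int[P]_w (expR (- (s * S w)))%:E)%E = (expR (- ((2 * s) `^ gamma)))%:E.
Proof.
have /andP[_] := gamma01; rewrite le_eqVlt => /predU1P[g1|g1] s0; last first.
  by have [_ _ /(_ _ s0)] := hS.1 g1; rewrite unlock.
transitivity (\int[P]_w (cst (expR (- (2 * s)))%:E w))%E.
  apply: ae_eq_integral => //.
    apply/measurable_EFinP; apply: measurableT_comp => //.
    by apply: measurableT_comp => //; exact: measurable_funM.
  by apply: filterS (hS.2 g1) => w /= -> _; rewrite mulrC.
by rewrite integral_cst_probability g1 powRr1// mulr_ge0.
Qed.

End one_sided_stable.

(** * The law of [2 W (2 / S)^2] *)

Section mixing_law.
Context d (T : measurableType d) (R : realType) (P : probability T R).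

(** The finite value [c] makes [f] integrable, so linearity applies. It serves with [k = 1] for the
    mixing law and [k = 1/2] for the Laplace transform. *)
Lemma integral_1BZ (f : T -> R) (k c : R) : measurable_fun setT f ->
  (forall w, 0 <= f w) -> (\int[P]_w (f w)%:E = c%:E)%E ->
  (\int[P]_w (1 - k * f w)%:E)%E = (1 - k * c)%:E.
Proof.
move=> mf f0 fc.
have fi : P.-integrable setT (EFin \o f).
  apply/integrableP; split; first exact/measurable_EFinP.
  by under eq_integral do rewrite /= ger0_norm//; rewrite fc ltry.
rewrite integralB_EFin//.
- rewrite integral_cst_probability.
  under eq_integral do rewrite EFinM.
  by rewrite integralZl// fc.
- exact: finite_measure_integrable_cst.
- rewrite (_ : _ \o _ = fun w => k%:E * (f w)%:E)%E; last first.
    by apply/funext => w /=.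
  exact: integrableZl.
Qed.

Variables W S : {RV P >-> R}.
Hypothesis hW : std_exponential W.
Hypothesis WS : independent2 P W S.
Hypothesis S_gt0 : {ae P, forall w, 0 < S w}.

Lemma mixing_dfE (y : R) :
  P [set w | 2 * W w * (2 / S w) ^+ 2 <= y] = (mixing_df (RV_df S) y)%:E.
Proof.
rewrite cdf_mixture// /mixing_df; case: ltP => // y0.
pose e (z : R) := expR (- (8^-1 * y * z ^+ 2)).
have me : measurable_fun setT e.
  apply: measurableT_comp => //; apply: measurableT_comp => //.
  by apply: measurable_funM => //; exact: measurable_funX.
have meS : measurable_fun setT (e \o S) by exact: measurableT_comp.
have e1 z : e z <= 1.
  by rewrite -expR0 ler_expR oppr_le0 mulr_ge0 ?sqr_ge0// mulr_ge0.
(* Finiteness is needed because [mixing_df] uses the real-valued integral, a [fine] part. *)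
have eSfin : (\int[P]_w (e (S w))%:E)%E \is a fin_num.
  rewrite ge0_fin_numE; last first.
    by apply: integral_ge0 => w _; rewrite lee_fin expR_ge0.
  apply: (@le_lt_trans _ _ (\int[P]_w cst 1%E w)%E).
    apply: ge0_le_integral => //.
    - by move=> w _; rewrite lee_fin expR_ge0.
    - exact/measurable_EFinP.
    - by move=> w _; rewrite lee_fin.
  by rewrite integral_cst_probability ltry.
have := @integral_1BZ (e \o S) 1 (fine (\int[P]_w (e (S w))%:E)) meS.
rewrite fineK// => /(_ (fun=> expR_ge0 _) erefl).
under eq_integral do rewrite mul1r.
rewrite mul1r => ->; congr (1 - fine _)%:E.
rewrite (eq_measure_integral (distribution P (borel_fun S))); last first.
  by move=> A mA _; exact: lebesgue_stieltjes_RV_df.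
have mSpos : measurable (S @^-1` `]0, +oo[).
  by apply: measurable_funPTI; exact: measurable_itv.
rewrite [RHS](ge0_integral_pushforward (phi := borel_fun S))//.
(* Restricting to the preimage of the open half-line loses nothing, as [S > 0] almost everywhere. *)
- rewrite [RHS]integral_mkcond; apply: ae_eq_integral => //.
  + exact/measurable_EFinP.
  + apply/(measurable_restrictT _ mSpos)/measurable_funTS.
    exact/measurable_EFinP.
  + apply: filterS S_gt0 => w Sw _; rewrite patchE ifT//.
    by rewrite inE/= in_itv/= andbT.
- apply/measurable_EFinP; apply: measurable_funTS; exact: me.
Qed.

Lemma integral_mixing_df (G : R -> \bar R) : measurable_fun setT G ->
  (forall y, 0 <= G y)%E ->
  (\int[P]_w G (2 * W w * (2 / S w) ^+ 2)%R =
   \int[lebesgue_stieltjes_measure (mixing_df (RV_df S))]_(y in `]0%R, +oo[)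
     G y)%E.
Proof.
move=> mG G0.
pose Y w := 2 * W w * (2 / S w) ^+ 2.
have mY : measurable_fun setT Y.
  apply: measurable_funM; first exact: measurable_funM.
  apply: measurable_funX; apply: measurable_funM => //.
  exact: (measurableT_comp (@measurable_inv R)).
pose Ym : {RV P >-> R} := HB.pack Y (isMeasurableFun.Build _ _ _ _ Y mY).
rewrite (eq_measure_integral (distribution P (borel_fun Ym))); last first.
  move=> A mA _; move: A mA; apply: (@lebesgue_stieltjes_measure_eq R
    (mixing_df (RV_df S)) (distribution P (borel_fun Ym))) => y.
  by rewrite -mixing_dfE; congr (P _).
(* The complementary half-line is null: the distribution function at 0 is [1 - expR 0 = 0]. *)
rewrite -setCitvl -[~` _]setTD -ge0_negligible_integral//.
  by rewrite ge0_integral_distribution.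
transitivity (P [set w | 2 * W w * (2 / S w) ^+ 2 <= 0]); first by congr (P _).
rewrite cdf_mixture// ltxx; apply: integral0_eq => w _.
by rewrite mulr0 mul0r oppr0 expR0 subrr.
Qed.

End mixing_law.

Theorem corollary4 (R : realType) (gamma : R) (gamma01 : 0 < gamma <= 1)
    (d' : measure_display) (T' : measurableType d') (P' : probability T' R)
    (Wt : {RV P' >-> R}) (hWt : two_sided_Weibull gamma Wt)
    (d : measure_display) (T : measurableType d) (P : probability T R)
    (W1 S : {RV P >-> R}) (V : T -> R)
    (hW1 : std_exponential W1)
    (hS : one_sided_stable gamma S)
    (hV : V = fun w => 2 / S w)
    (W1V : independent2 P W1 V) :
  forall x : R,
    P' [set w | Wt w < x] =
      'E_P[fun w => std_normal_df (x / Num.sqrt (2 * W1 w * V w ^+ 2))]%E /\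
    'E_P[fun w => std_normal_df (x / Num.sqrt (2 * W1 w * V w ^+ 2))]%E =
      (\int[lebesgue_stieltjes_measure (mixing_df (RV_df S))]_(y in `]0%R, +oo[)
         (std_normal_df (x / Num.sqrt y))%:E)%E.
Proof.
move=> x; subst V.
have S0 := one_sided_stable_gt0 gamma01 hS.
(* Independence passes from [V] to [S = 2 / V], an identity that holds even where [S] is 0, by the
   convention [0^-1 = 0]. *)
have W1S : independent2 P W1 S.
  rewrite (_ : (S : T -> R) = (fun v => 2 / v) \o (fun w => 2 / S w)).
    apply: independent2_comp W1V; apply: measurable_funM => //.
    exact: measurable_inv.
  by apply/funext => w /=; rewrite invf_div mulrC divfK// pnatr_eq0.
rewrite unlock; split.
- rewrite hWt integral_Phi_mixture//.
  have x20 : 0 <= `|x| / 2 by rewrite divr_ge0.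
  have mE : measurable_fun setT (fun w => expR (- (`|x| / 2 * S w))).
    apply: measurableT_comp => //; apply: measurableT_comp => //.
    exact: measurable_funM.
  (* At [s = |x| / 2] the transform has [2 * s = |x|], which produces the Weibull exponent. *)
  have LE := one_sided_stable_laplace gamma01 hS x20.
  rewrite mulrCA divff ?pnatr_eq0// mulr1 in LE.
  rewrite /laplace_df /two_sided_Weibull_df; case: ltP => x0.
    under eq_integral do rewrite EFinM.
    rewrite ge0_integralZl//.
    + by rewrite LE.
    + exact/measurable_EFinP.
  have E1 := integral_1BZ 2^-1 mE (fun=> expR_ge0 _) LE.
  by rewrite ger0_norm// in E1 *; exact: esym E1.
- apply: (integral_mixing_df hW1 W1S S0
    (G := fun y => (std_normal_df (x / Num.sqrt y))%:E)).
  + apply/measurable_EFinP.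
    apply: (measurableT_comp (@measurable_std_normal_df R)).
    apply: measurable_funM => //.
    exact: (measurableT_comp (@measurable_inv R) (@measurable_sqrt R)).
  + by move=> y; rewrite lee_fin std_normal_df_ge0.
Qed.
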